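(* Let $(M,F=\alpha^2/\beta)$ be a Kropina space, where $\alpha=\sqrt{a_{ij}(x)y^iy^j}$ and $\beta=b_i(x)y^i$, and let $(h,W)$ be the navigation data of $F$. Then the Kropina space $(M,\alpha^2/\beta)$ is a Berwald space if and only if $W$ is parallel with respect to the Levi-Civita connection of the metric $h$. In this case, the coefficients ${{G_j}^i}_k$ of the Berwald connection of $F$ coincide with the coefficients ${}^h{{\gamma_j}^i}_k$ of the Levi-Civita connection of $h$. In other words, the geodesics of a Kropina space $(M,F=\alpha^2/\beta)$ which is a Berwald space coincide with those of the Riemannian space $(M,h)$.
   Context: A Kropina space $(M,F)$ is an $n$-dimensional differentiable manifold $M$ with a Kropina metric $F=\alpha^2/\beta$, where $\alpha=\sqrt{a_{ij}(x)y^iy^j}$ is a Riemannian metric on $M$ and $\beta=b_i(x)y^i$ is a 1-form on $M$. Navigation data: put $b^2:=a^{ij}b_ib_j$, where $(a^{ij})$ is the inverse matrix of $(a_{ij})$. The Kropina metric is characterized by a Riemannian metric $h=\sqrt{h_{ij}(x)y^iy^j}$ and a vector field $W=W^i\,\partial/\partial x^i$ of constant length $1$ with respect to $h$, given by $h_{ij}:=e^{\kappa(x)}a_{ij}$, $2W_i:=e^{\kappa(x)}b_i$, $e^{\kappa(x)}b^2=4$, for a function $\kappa(x)$ of the position $(x^i)$ alone, where $W_i:=h_{ij}W^j$. The pair $(h,W)$ is called the navigation data of $F$. Berwald space: let $G^i$ be the coefficients of the geodesic spray of a Finsler space $(M,F)$, normalized so that the geodesic equation is $\ddot x^i+2G^i(x,\dot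 x)=0$, and put ${G^i}_j:=\partial G^i/\partial y^j$, ${{G_j}^i}_k:=\partial {G^i}_j/\partial y^k$ (the coefficients of the Berwald connection), ${{G_j}^i}_{kl}:=\partial {{G_j}^i}_k/\partial y^l$. The space $(M,F)$ is called a Berwald space if ${{G_j}^i}_{kl}=0$, that is, if the coefficients ${{G_j}^i}_k$ are functions of the position $(x^i)$ alone. The ${}^h{{\gamma_j}^i}_k$ are the Christoffel symbols of the Riemannian metric $h$. *)

(* Defs.v *)
From mathcomp Require Import all_boot all_order all_algebra.
From mathcomp Require Import all_classical all_reals all_analysis.

Set Implicit Arguments.
Unset Strict Implicit.
Unset Printing Implicit Defensive.

Import Order.TTheory GRing.Theory Num.Theory.
Import numFieldNormedType.Exports.

Local Open Scope classical_set_scope.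
Local Open Scope ring_scope.

(* Points of R^n, tangent vectors and covectors are row vectors; the component
   x^i is [x 0 i]. *)

Section Calculus.
Variables (R : realType) (n : nat).
Implicit Types (U : set 'rV[R]_n) (f : 'rV[R]_n -> R).

Definition pderiv (i : 'I_n) f : 'rV[R]_n -> R :=
  fun x => 'D_(delta_mx 0 i) f x.

Fixpoint Ck (k : nat) U f : Prop :=
  (forall x, U x -> {for x, continuous f}) /\
  if k is k'.+1 then
    forall i : 'I_n,
      (forall x, U x -> derivable f x (delta_mx 0 i)) /\ Ck k' U (pderiv i f)
  else True.

Definition smooth U f : Prop := forall k, Ck k U f.

Definition qform (A : 'M[R]_n) (y : 'rV[R]_n) : R :=
  \sum_(i < n) \sum_(j < n) A i j * y 0 i * y 0 j.

End Calculus.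

(* A smooth atlas on M; all statements below quantify over all of its charts,
   so the atlas may or may not be taken maximal.  [chart_inv c] is only
   relevant on the image of [chart_map c]. *)
Record smooth_manifold (R : realType) (n : nat) (M : topologicalType) :=
  SmoothManifold {
    chart :> Type;
    chart_dom : chart -> set M;
    chart_map : chart -> M -> 'rV[R]_n;
    chart_inv : chart -> 'rV[R]_n -> M;
    manifold_hausdorff : hausdorff_space M;
    manifold_second_countable : @second_countable M;
    chart_cover : forall p : M, exists c, chart_dom c p;
    chart_dom_open : forall c, open (chart_dom c);
    chart_img_open : forall c, open (chart_map c @` chart_dom c);
    chart_mapK : forall c p, chart_dom c p -> chart_inv c (chart_map c p) = p;
    chart_map_continuous : forall c p, chart_dom c p ->
      {for p, continuous (chart_map c)};
    chart_inv_continuous : forall c x, (chart_map c @` chart_dom c) x ->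
      {for x, continuous (chart_inv c)};
    chart_smooth : forall c d (i : 'I_n),
      smooth (chart_map c @` (chart_dom c `&` chart_dom d))
             (fun x => chart_map d (chart_inv c x) 0 i) }.

Section Tensors.
Variables (R : realType) (n : nat) (M : topologicalType).
Variable A : smooth_manifold R n M.
Implicit Types (c d : A) (x y : 'rV[R]_n) (i j k l : 'I_n).

Definition chart_img c : set 'rV[R]_n := chart_map c @` chart_dom c.

Definition overlap c d : set 'rV[R]_n :=
  chart_map c @` (chart_dom c `&` chart_dom d).

Definition transition c d : 'rV[R]_n -> 'rV[R]_n :=
  fun x => chart_map d (chart_inv c x).

(* Tensor fields are given by their components in each chart, as functions of
   the coordinates, subject to the tensor transformation law.  The entry (i, k)
   of the Jacobian ['J f x] is the derivative of the k-th component of f in the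
   direction of the i-th coordinate. *)
Record riemannian_metric := RiemannianMetric {
  metric_comp :> A -> 'rV[R]_n -> 'M[R]_n;
  metric_smooth : forall c i j,
    smooth (chart_img c) (fun x => metric_comp c x i j);
  metric_sym : forall c x, chart_img c x ->
    (metric_comp c x)^T = metric_comp c x;
  metric_posdef : forall c x, chart_img c x ->
    forall y, y != 0 -> 0 < qform (metric_comp c x) y;
  metric_transition : forall c d x, overlap c d x ->
    metric_comp c x =
      'J (transition c d) x *m metric_comp d (transition c d x)
        *m ('J (transition c d) x)^T }.

Record one_form := OneForm {
  form_comp :> A -> 'rV[R]_n -> 'rV[R]_n;
  form_smooth : forall c i,
    smooth (chart_img c) (fun x => form_comp c x 0 i);
  form_transition : forall c d x, overlap c d x ->
    form_comp c x =
      form_comp d (transition c d x) *m ('J (transition c d) x)^T }.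

Record vector_field := VectorField {
  field_comp :> A -> 'rV[R]_n -> 'rV[R]_n;
  field_smooth : forall c i,
    smooth (chart_img c) (fun x => field_comp c x 0 i);
  field_transition : forall c d x, overlap c d x ->
    field_comp d (transition c d x) =
      field_comp c x *m 'J (transition c d) x }.

Section LeviCivita.
Variable h : riemannian_metric.

(* [christoffel c x j i k] is the symbol with lower indices j, k and upper
   index i. *)
Definition christoffel c x j i k : R :=
  2^-1 * \sum_(l < n) invmx (h c x) i l *
    (pderiv j (fun z => h c z l k) x + pderiv k (fun z => h c z j l) x
     - pderiv l (fun z => h c z j k) x).

Definition parallel (W : vector_field) : Prop :=
  forall c x, chart_img c x -> forall i j,
    pderiv j (fun z => W c z 0 i) x
      + \sum_(k < n) christoffel c x j i k * W c x 0 k = 0.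

Definition riemannian_spray c x y i : R :=
  2^-1 * \sum_(j < n) \sum_(k < n) christoffel c x j i k * y 0 j * y 0 k.

End LeviCivita.

Section Finsler.
(* A Finsler function, in the coordinates (x, y) of each chart, with the conic
   domain D of tangent vectors on which it is defined. *)
Variables (D : A -> 'rV[R]_n -> set 'rV[R]_n).
Variables (F : A -> 'rV[R]_n -> 'rV[R]_n -> R).

Definition fundamental_tensor c x y : 'M[R]_n :=
  \matrix_(i, j) (2^-1 * pderiv j (pderiv i (fun v => F c x v ^+ 2)) y).

Definition spray c x y i : R :=
  4^-1 * \sum_(l < n) invmx (fundamental_tensor c x y) i l *
    ((\sum_(k < n)
        pderiv l (fun v => pderiv k (fun z => F c z v ^+ 2) x) y * y 0 k)
     - pderiv l (fun z => F c z y ^+ 2) x).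

Definition nonlinear_connection c x y i j : R :=
  pderiv j (fun v => spray c x v i) y.

(* In the two definitions below i is the upper index. *)
Definition berwald_connection c x y j i k : R :=
  pderiv k (fun v => nonlinear_connection c x v i j) y.

Definition berwald_curvature c x y j i k l : R :=
  pderiv l (fun v => berwald_connection c x v j i k) y.

Definition berwald_space : Prop :=
  forall c x y, chart_img c x -> D c x y ->
    forall i j k l, berwald_curvature c x y j i k l = 0.

End Finsler.

Section Geodesics.
Variables (J : set R) (gamma : R -> M).

Definition coord_curve c : R -> 'rV[R]_n := fun t => chart_map c (gamma t).

Definition admissible (D : A -> 'rV[R]_n -> set 'rV[R]_n) : Prop :=
  forall c t, J t -> chart_dom c (gamma t) ->
    D c (coord_curve c t) (derive1 (coord_curve c) t).

Definition solves_spray (G : A -> 'rV[R]_n -> 'rV[R]_n -> 'I_n -> R) : Prop :=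
  (forall t, J t -> {for t, continuous gamma}) /\
  forall c t, J t -> chart_dom c (gamma t) ->
    [/\ derivable (coord_curve c) t 1,
        derivable (derive1 (coord_curve c)) t 1 &
        forall i, derive1n 2 (coord_curve c) t 0 i
          + 2 * G c (coord_curve c t) (derive1 (coord_curve c) t) i = 0].

Definition finsler_geodesic D F : Prop :=
  admissible D /\ solves_spray (spray F).

Definition riemannian_geodesic (h : riemannian_metric) : Prop :=
  solves_spray (riemannian_spray h).

End Geodesics.

Section Kropina.
Variables (a : riemannian_metric) (b : one_form).

Definition alpha c x y : R := Num.sqrt (qform (a c x) y).

Definition beta c x y : R := \sum_(i < n) b c x 0 i * y 0 i.

Definition kropina c x y : R := alpha c x y ^+ 2 / beta c x y.

Definition kropina_dom c x : set 'rV[R]_n := [set y | 0 < beta c x y].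

(* The last condition forces b to vanish nowhere and determines kappa, hence
   also h and W, from a and b. *)
Definition navigation_data (kappa : M -> R)
    (h : riemannian_metric) (W : vector_field) : Prop :=
  forall c p, chart_dom c p ->
    let x := chart_map c p in
    [/\ qform (h c x) (W c x) = 1,
        forall i j, h c x i j = expR (kappa p) * a c x i j,
        forall i, 2 * (\sum_(j < n) h c x i j * W c x 0 j)
                  = expR (kappa p) * b c x 0 i &
        expR (kappa p) * qform (invmx (a c x)) (b c x) = 4].

End Kropina.
End Tensors.

(* Main.v *)
Require Import Defs.
From mathcomp Require Import all_boot all_order all_algebra.
From mathcomp Require Import all_classical all_reals all_analysis.
From mathcomp Require Import ring lra.
Set Implicit Arguments.
Unset Strict Implicit.
Unset Printing Implicit Defensive.

Import Order.TTheory GRing.Theory Num.Theory.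
Import numFieldNormedType.Exports.

Local Open Scope classical_set_scope.
Local Open Scope ring_scope.

(** The navigation relations rescale [a] and [b] by the same factor, so that
    [F = s / (2 t)] with [s = h(y, y)], [t = h(W, y)] and [h(W, W) = 1]; the
    conformal factor disappears.  Everything is then compared with the spray
    [G_h] of [h].

    Write [N] for the covariant derivative of [W], lowered with [h].  Since [s]
    is horizontally constant for the Levi-Civita connection and the horizontal
    derivative of [t] is given by [N], the equation defining the spray [G] of [F]
    becomes an equation for [D = G - G_h] whose right-hand side only involves
    [N(y, y)] and the curl of [N].  Pairing that equation with [y] and with [W]
    gives [h(y, D)] and [h(W, D)], and then [D] itself
    ([spray_difference_solution], [kspray_difference]):

      [4 s t D = 2 t k y - s k W - s^2 curl N(y)],
      with [k = s N(W, y) - 2 t N(y, y)].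

    The same computation with zero right-hand side shows that the fundamental
    tensor is invertible wherever [t > 0].

    If [W] is parallel then [N = 0], hence [G = G_h], and both the connection
    coefficients and the geodesics are those of [h].

    Conversely the formula makes [G] a rational function of [y] on the
    half-space [t > 0], so that a Berwald spray is quadratic along every line
    contained in the half-space ([rational_line_quadratic]).  The lines
    [W + z u] with [u] orthogonal to [W] are such lines, because [t = 1] on
    them.  Along them [s = 1 + h(u, u) z^2], and comparing coefficients of
    powers of [z] in the formula forces [N = 0]
    ([quadratic_difference_rigidity]). *)

(** * Rational functions on an open set *)

Section Calculus.
Variables (R : realType) (n : nat).
Implicit Types (Om : set 'rV[R]_n) (f g : 'rV[R]_n -> R) (y u : 'rV[R]_n).

Lemma eq_on_is_derive Om f g y u df : open Om -> Om y ->
  (forall z, Om z -> f z = g z) -> is_derive y u f df -> is_derive y u g df.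
Proof.
move=> oOm Omy fg; apply: near_eq_is_derive.
by near=> z; apply: fg; near: z; exact: open_nbhs_nbhs.
Unshelve. all: end_near. Qed.

Lemma eq_on_pderiv Om f g y i : open Om -> Om y ->
  (forall z, Om z -> f z = g z) -> pderiv i f y = pderiv i g y.
Proof.
move=> oOm Omy fg; apply: near_eq_derive.
by near=> z; apply: fg; near: z; exact: open_nbhs_nbhs.
Unshelve. all: end_near. Qed.

(** The difference quotients of a linear function are constant, which makes
    continuity irrelevant. *)
Lemma is_derive_linear f y u :
  (forall r v, f (r *: u + v) = r * f u + f v) -> is_derive y u f (f u).
Proof.
move=> fl; have cv : (fun r : R => r^-1 *: ((f \o shift y) (r *: u) - f y)) @ 0^'
    --> f u.
  apply: (@cvg_trans _ (cst (f u) @ (0 : R)^')); last exact: cvg_cst.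
  apply: near_eq_cvg; near=> r => /=.
  rewrite fl addrK /GRing.scale/= mulrA mulVf ?mul1r//.
  by near: r; exact: nbhs_dnbhs_neq.
by split; [apply: cvgP cv | exact: cvg_lim cv].
Unshelve. all: end_near. Qed.

Lemma is_derive_inv f y u df : f y != 0 -> is_derive y u f df ->
  is_derive y u (fun z => (f z)^-1) (- df / f y ^+ 2).
Proof.
move=> fy0 [dfy <-]; split; first exact: derivableV.
by rewrite deriveV// /GRing.scale/= mulrC mulrN mulNr.
Qed.

Lemma is_derive_quot (f g : 'rV[R]_n -> R) y e df dg : g y != 0 ->
  is_derive y e f df -> is_derive y e g dg ->
  is_derive y e (fun v => f v / g v) ((df * g y - f y * dg) / g y ^+ 2).
Proof.
move=> gy0 dfE dgE; apply: is_derive_eq (is_deriveM dfE (is_derive_inv gy0 dgE)) _.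
by rewrite /GRing.scale/=; field.
Qed.

Lemma is_derive_expn (f : 'rV[R]_n -> R) y e df k :
  is_derive y e f df -> is_derive y e (fun v => f v ^+ k) (k%:R * f y ^+ k.-1 * df).
Proof.
move=> dfE; rewrite (_ : (fun v => f v ^+ k) = f ^+ k).
  exact: (is_deriveX k dfE).
by apply/funext => v; rewrite exprfctE.
Qed.

Lemma is_derive_scale (r : R) (f : 'rV[R]_n -> R) y e df :
  is_derive y e f df -> is_derive y e (fun v => r * f v) (r * df).
Proof. by move=> dfE; exact: (is_deriveZ r dfE). Qed.

Lemma sum_delta (F : 'I_n -> R) i :
  \sum_(k < n) (delta_mx 0 i : 'rV[R]_n) 0 k * F k = F i.
Proof.
rewrite (bigD1 i)//= mxE !eqxx mul1r big1 ?addr0// => k ki.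
by rewrite mxE (negPf ki) andbF mul0r.
Qed.

(** Closure under extensional equality on [Om] is part of the definition: the
    functions of interest, such as spray coefficients, agree with a rational
    expression only where the Finsler function is defined. *)
Inductive rational_on Om : ('rV[R]_n -> R) -> Prop :=
| rational_cst r : rational_on Om (fun=> r)
| rational_coord i : rational_on Om (fun y => y 0 i)
| rational_add f g : rational_on Om f -> rational_on Om g ->
    rational_on Om (fun y => f y + g y)
| rational_mul f g : rational_on Om f -> rational_on Om g ->
    rational_on Om (fun y => f y * g y)
| rational_inv f : rational_on Om f -> (forall y, Om y -> f y != 0) ->
    rational_on Om (fun y => (f y)^-1)
| rational_ext f g : rational_on Om f -> (forall y, Om y -> f y = g y) ->
    rational_on Om g.

Lemma rational_opp Om f : rational_on Om f -> rational_on Om (fun y => - f y).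
Proof.
move=> rf; apply: rational_ext (rational_mul (rational_cst _ (-1)) rf) _ => y _.
by rewrite mulN1r.
Qed.

Lemma rational_sum Om (I : finType) (f : I -> 'rV[R]_n -> R) :
  (forall i, rational_on Om (f i)) ->
  rational_on Om (fun y => \sum_i f i y).
Proof.
move=> rf; elim: (index_enum I) => [|i s IH].
  by apply: rational_ext (rational_cst _ 0) _ => y _; rewrite big_nil.
by apply: rational_ext (rational_add (rf i) IH) _ => y _; rewrite big_cons.
Qed.

(** The gradient is built along with the function, since partial derivatives
    alone would not control the derivatives in other directions. *)
Lemma rational_gradient Om f : open Om -> rational_on Om f ->
  exists2 df : 'I_n -> 'rV[R]_n -> R, (forall k, rational_on Om (df k)) &
    forall y, Om y -> forall u, is_derive y u f (\sum_(k < n) u 0 k * df k y).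
Proof.
move=> oOm; elim=> {f} [r|i|f g rf [df rdf dfE] rg [dg rdg dgE]
  |f g rf [df rdf dfE] rg [dg rdg dgE]|f rf [df rdf dfE] f0
  |f g _ [df rdf dfE] fg].
- exists (fun _ _ => 0) => [k|y _ u]; first exact: rational_cst.
  rewrite big1; first exact: is_derive_cst.
  by move=> k _; rewrite mulr0.
- exists (fun k _ => (delta_mx 0 i : 'rV[R]_n) 0 k) => [k|y _ u].
    exact: rational_cst.
  under eq_bigr do rewrite mulrC; rewrite sum_delta.
  by apply: (@is_derive_linear (fun z => z 0 i)) => r v; rewrite !mxE.
- exists (fun k y => df k y + dg k y) => [k|y Omy u]; first exact: rational_add.
  under eq_bigr do rewrite mulrDr; rewrite big_split/=.
  exact: is_deriveD (dfE _ Omy u) (dgE _ Omy u).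
- exists (fun k y => f y * dg k y + g y * df k y) => [k|y Omy u].
    by apply: rational_add; apply: rational_mul.
  apply: is_derive_eq (is_deriveM (dfE _ Omy u) (dgE _ Omy u)) _.
  rewrite /GRing.scale/= !mulr_sumr -big_split/=; apply: eq_bigr => k _; ring.
- exists (fun k y => - df k y * ((f y)^-1 * (f y)^-1)) => [k|y Omy u].
    apply: rational_mul; first exact: rational_opp.
    by apply: rational_mul; apply: rational_inv.
  apply: is_derive_eq (is_derive_inv (f0 _ Omy) (dfE _ Omy u)) _.
  rewrite expr2 invfM -sumrN mulr_suml; apply: eq_bigr => k _; ring.
- exists df => // y Omy u.
  exact: eq_on_is_derive oOm Omy fg (dfE _ Omy u).
Qed.

Lemma rational_pderiv Om f : open Om -> rational_on Om f ->
  (forall i, rational_on Om (pderiv i f)) /\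
  forall y, Om y -> forall u,
    is_derive y u f (\sum_(k < n) u 0 k * pderiv k f y).
Proof.
move=> oOm /(rational_gradient oOm)[df rdf dfE].
have pE i y : Om y -> df i y = pderiv i f y.
  by move=> Omy; rewrite -[LHS](sum_delta (df^~ y)); case: (dfE y Omy (delta_mx 0 i)).
split=> [i|y Omy u]; first exact: rational_ext (rdf i) (pE i).
by under eq_bigr do rewrite -pE//; exact: dfE.
Qed.

Lemma is_derive_wsum (V : normedModType R) (I : finType) (c : I -> R)
    (g : I -> V -> R) (x v : V) (dg : I -> R) :
  (forall i, is_derive x v (g i) (dg i)) ->
  is_derive x v (fun z => \sum_i c i * g i z) (\sum_i c i * dg i).
Proof.
move=> dgE; elim: (index_enum I) => [|i s IH].
  rewrite big_nil; under eq_fun do rewrite big_nil; exact: is_derive_cst.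
rewrite big_cons; under eq_fun do rewrite big_cons.
apply: is_deriveD; exact: (is_deriveZ (c i) (dgE i)).
Qed.

(** Both sides are limits of the same difference quotients. *)
Lemma is_derive_line f y u (z df : R) : is_derive (y + z *: u) u f df ->
  is_derive z 1 (fun r => f (y + r *: u)) df.
Proof.
have E : (fun r : R => r^-1 *: (((fun r => f (y + r *: u)) \o shift z) (r *: 1) - f
    (y + z *: u)))
  = (fun r => r^-1 *: ((f \o shift (y + z *: u)) (r *: u) - f (y + z *: u))).
  apply/funext => r /=; congr (_ *: (f _ - _)).
  by rewrite [r *: 1]mulr1 scalerDl addrCA addrA.
by case=> d1 d2; split; rewrite /derivable /derive E.
Qed.

Lemma quadratic_of_derive3_eq0 (f f1 f2 : R -> R) :
  (forall z : R, is_derive z 1 f (f1 z)) ->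
  (forall z : R, is_derive z 1 f1 (f2 z)) ->
  (forall z : R, is_derive z 1 f2 0) ->
  forall z, f z = f 0 + f1 0 * z + f2 0 / 2 * z ^+ 2.
Proof.
move=> d1 d2 d3 z.
have lin (a t : R) : is_derive t 1 (fun r : R => a * r) a.
  by apply: is_derive_eq (is_deriveZ a (is_derive_id t 1)) _; exact: mulr1.
have sqr (a t : R) : is_derive t 1 (fun r : R => a * (r * r)) (a * (t + t)).
  apply: is_derive_eq (is_deriveZ a (is_deriveM (is_derive_id t 1) (is_derive_id t
      1))) _.
  by rewrite /GRing.scale/= !mulr1.
have e2 x : f2 x = f2 0 by exact: is_derive_0_is_cst.
have e1 x : f1 x = f1 0 + f2 0 * x.
  have : f1 x - f2 0 * x = f1 0 - f2 0 * 0.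
    apply: (@is_derive_0_is_cst _ (fun r => f1 r - f2 0 * r)) => t.
    apply: is_derive_eq (is_deriveB (d2 t) (lin (f2 0) t)) _.
    by rewrite e2 subrr.
  by rewrite mulr0 subr0 => /eqP; rewrite subr_eq => /eqP.
have : f z - (f1 0 * z + f2 0 / 2 * (z * z))
     = f 0 - (f1 0 * 0 + f2 0 / 2 * (0 * 0)).
  apply: (@is_derive_0_is_cst _ (fun r => f r - (f1 0 * r + f2 0 / 2 * (r * r))))
      => t.
  apply: is_derive_eq (is_deriveB (d1 t) (is_deriveD (lin (f1 0) t) (sqr (f2 0 / 2)
      t))) _.
  by rewrite e1; field.
by move=> /eqP; rewrite subr_eq => /eqP ->; ring.
Qed.

(** By the chain rule the third derivative along the line is a combination of
    third partial derivatives. *)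
Lemma rational_line_quadratic Om f y u : open Om -> rational_on Om f ->
  (forall z : R, Om (y + z *: u)) ->
  (forall x, Om x -> forall j k l, pderiv l (pderiv k (pderiv j f)) x = 0) ->
  exists a b c, forall z : R, f (y + z *: u) = a + b * z + c * z ^+ 2.
Proof.
move=> oOm rf Omz f3.
have [r1 d1] := rational_pderiv oOm rf.
have r2 j := (rational_pderiv oOm (r1 j)).1.
have d2 j := (rational_pderiv oOm (r1 j)).2.
have d3 j k := (rational_pderiv oOm (r2 j k)).2.
pose f1 r := \sum_(k < n) u 0 k * pderiv k f (y + r *: u).
pose f2 r := \sum_(j < n) u 0 j * \sum_(k < n) u 0 k * pderiv k (pderiv j f) (y + r
    *: u).
eexists _, _, _; apply: (@quadratic_of_derive3_eq0 (fun r => f (y + r *: u)) f1 f2).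
- by move=> z; apply: is_derive_line; exact: d1.
- move=> z.
  exact: (is_derive_wsum (u 0) (fun j => is_derive_line (d2 j _ (Omz z) u))).
- move=> z.
  apply: is_derive_eq (is_derive_wsum (u 0) (fun j => is_derive_wsum (u 0)
    (fun k => is_derive_line (d3 j k _ (Omz z) u)))) _.
  rewrite big1// => j _; rewrite big1 ?mulr0// => k _.
  by rewrite big1 ?mulr0// => l _; rewrite f3// mulr0.
Qed.

End Calculus.

(** * The linear algebra of the spray equation *)

Section Pairing.
Variables (R : realType) (n : nat).
Implicit Types (xi u v y W : 'rV[R]_n) (H A : 'M[R]_n).

Definition pair xi u : R := \sum_(i < n) xi 0 i * u 0 i.

Lemma pairE xi u : pair xi u = (xi *m u^T) 0 0.
Proof. by rewrite !mxE; apply: eq_bigr => i _; rewrite mxE. Qed.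

Lemma pairDl xi1 xi2 u : pair (xi1 + xi2) u = pair xi1 u + pair xi2 u.
Proof. by rewrite !pairE mulmxDl mxE. Qed.

Lemma pairDr xi u v : pair xi (u + v) = pair xi u + pair xi v.
Proof. by rewrite !pairE linearD/= mulmxDr mxE. Qed.

Lemma pairZl r xi u : pair (r *: xi) u = r * pair xi u.
Proof. by rewrite !pairE -scalemxAl mxE. Qed.

Lemma pairZr r xi u : pair xi (r *: u) = r * pair xi u.
Proof. by rewrite !pairE linearZ/= -scalemxAr mxE. Qed.

Lemma pairC xi u : pair xi u = pair u xi.
Proof. by apply: eq_bigr => i _; rewrite mulrC. Qed.

Lemma pair0l u : pair 0 u = 0.
Proof. by rewrite pairE mul0mx mxE. Qed.

Lemma pair0r u : pair u 0 = 0.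
Proof. by rewrite pairC pair0l. Qed.

Lemma pair_mul A u v : pair (u *m A) v = pair (v *m A^T) u.
Proof. by rewrite [RHS]pairC !pairE trmx_mul trmxK mulmxA. Qed.

Lemma pair_sym H u v : H^T = H -> pair (u *m H) v = pair (v *m H) u.
Proof. by move=> Hs; rewrite pair_mul Hs. Qed.

Lemma pair_delta xi i : pair xi (delta_mx 0 i) = xi 0 i.
Proof. by rewrite pairC /pair sum_delta. Qed.

Lemma qformE H y : qform H y = pair (y *m H) y.
Proof.
rewrite /qform /pair exchange_big/=; apply: eq_bigr => j _.
rewrite mxE mulr_suml; apply: eq_bigr => i _; ring.
Qed.

(** Five values determine a polynomial of degree four. *)
Lemma quartic_coefs_eq0 (c0 c1 c2 c3 c4 : R) :
  (forall z, c0 + c1 * z + c2 * z ^+ 2 + c3 * z ^+ 3 + c4 * z ^+ 4 = 0) ->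
  [/\ c0 = 0, c1 = 0, c2 = 0, c3 = 0 & c4 = 0].
Proof.
move=> P0; have := P0 0; have := P0 1; have := P0 (-1); have := P0 2.
by have := P0 (-2); split; lra.
Qed.

(** The bracket on the left is the fibre Hessian of [(s / (2 t))^2] applied to
    [v], and [C], [A0], [w] stand for [curl N(y)],
    [N(y, y)], [N(W, y)].  Pairing the hypothesis with [y] gives
    [4 t p = s (2 q - A0)]; pairing it with [W] then gives [q]; what remains is
    solved for [v]. *)
Lemma spray_difference_solution H W y v C (A0 w : R) :
  H^T = H -> pair (W *m H) W = 1 -> pair C y = 0 -> pair C W = - w ->
  let s := pair (y *m H) y in let t := pair (W *m H) y in
  let p := pair (y *m H) v in let q := pair (W *m H) v in
  s != 0 -> t != 0 ->
  (forall l, 2 * (2 * p * (y *m H) 0 l / t ^+ 2 + s * (v *m H) 0 l / t ^+ 2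
       - 2 * s * (p * (W *m H) 0 l + q * (y *m H) 0 l) / t ^+ 3
       + 3 * s ^+ 2 * q * (W *m H) 0 l / (2 * t ^+ 4))
     = A0 * (- 2 * s * (y *m H) 0 l / t ^+ 3
             + 3 * s ^+ 2 * (W *m H) 0 l / (2 * t ^+ 4))
       - s ^+ 2 / (2 * t ^+ 3) * C 0 l) ->
  forall l, 4 * s * t * (v *m H) 0 l
    = 2 * t * (s * w - 2 * t * A0) * (y *m H) 0 l
      - s * (s * w - 2 * t * A0) * (W *m H) 0 l - s ^+ 2 * C 0 l.
Proof.
move=> Hs W1 Cy CW s t p q s0 t0 E.
(* The coefficients of [y] and [W] in the equation multiplied by [2 t^4]. *)
pose a1 := 8 * t ^+ 2 * p - 8 * s * t * q + 4 * s * t * A0.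
pose a3 := 6 * s ^+ 2 * q - 8 * s * t * p - 3 * s ^+ 2 * A0.
have Ep l : a1 * (y *m H) 0 l + 4 * s * t ^+ 2 * (v *m H) 0 l
    + a3 * (W *m H) 0 l + s ^+ 2 * t * C 0 l = 0.
  have := E l; set Y := (y *m H) 0 l; set V := (v *m H) 0 l.
  set Z := (W *m H) 0 l => /(congr1 (fun r => r * (2 * t ^+ 4))) El.
  rewrite /a1 /a3; apply/eqP; rewrite -subr_eq0; apply/eqP.
  move: El; set L := LHS; set Rr := RHS => El.
  rewrite [LHS](_ : _ = L - Rr); first by rewrite El subrr.
  by rewrite /L /Rr; field.
have Ev : a1 *: (y *m H) + (4 * s * t ^+ 2) *: (v *m H)
    + a3 *: (W *m H) + (s ^+ 2 * t) *: C = 0.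
  by apply/rowP => l; rewrite !mxE -[RHS](Ep l) !mxE.
have /(congr1 (pair^~ y)) := Ev; rewrite !pairDl !pairZl pair0l Cy.
rewrite -/s -/t (pair_sym v y Hs) -/p => E1.
have {}E1 : 4 * t * p = 2 * s * q - s * A0.
  apply: (mulfI (mulf_neq0 s0 t0)); apply/eqP; rewrite -subr_eq0; apply/eqP.
  by rewrite -[RHS]E1 /a1 /a3; ring.
have /(congr1 (pair^~ W)) := Ev; rewrite !pairDl !pairZl pair0l CW W1.
rewrite (pair_sym y W Hs) (pair_sym v W Hs) -/q -/t => E2.
have {}E2 : 2 * s * q = s * A0 + s * t * w - 2 * t ^+ 2 * A0.
  apply: (mulfI s0); apply/eqP; rewrite -subr_eq0; apply/eqP.
  rewrite -[RHS]E2 /a1 /a3.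
  rewrite [RHS](_ : _ = (2 * t ^+ 2 - 2 * s) * (4 * t * p) + 6 * s ^+ 2 * q
     - 4 * s * t ^+ 2 * q + 4 * s * t ^+ 2 * A0 - 3 * s ^+ 2 * A0
     - s ^+ 2 * t * w); first by rewrite E1; ring.
  ring.
have F1 : a1 = - 2 * t * (s * t * w - 2 * t ^+ 2 * A0).
  rewrite /a1 [LHS](_ : _ = 2 * t * (4 * t * p) - 4 * t * (2 * s * q) + 4 * s * t *
      A0); last by ring.
  by rewrite E1 E2; ring.
have F3 : a3 = s * (s * t * w - 2 * t ^+ 2 * A0).
  rewrite /a3 [LHS](_ : _ = 3 * s * (2 * s * q) - 2 * s * (4 * t * p) - 3 * s ^+ 2
      * A0); last by ring.
  by rewrite E1 E2; ring.
move=> l; apply: (mulfI t0); have := Ep l; rewrite F1 F3.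
set Y := (y *m H) 0 l; set V := (v *m H) 0 l; set Z := (W *m H) 0 l => El.
apply/eqP; rewrite -subr_eq0; apply/eqP; rewrite -[RHS]El; ring.
Qed.

(** The exterior derivative of the covector [h(W, -)], contracted with [y],
    when [A] is its covariant derivative. *)
Definition curl A y : 'rV[R]_n := y *m A - y *m A^T.

(** The hypothesis says that the difference of sprays is quadratic along the
    lines [W + z u] with [u] orthogonal to [W], where [t = 1].  Its pairing with
    [W] shows that [A] vanishes on [(W, u)] and on [(u, u)], so that [A] is
    alternating.  The equation then reduces to [4 D = - s curl A], whose cubic
    coefficient makes [A(u, -)] symmetric; both together give [A = 0]. *)
Lemma quadratic_difference_rigidity H W A :
  H^T = H -> (forall u, u != 0 -> 0 < pair (u *m H) u) ->
  pair (W *m H) W = 1 -> (forall u, pair (u *m A) W = 0) ->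
  (forall u, pair (W *m H) u = 0 -> exists a b c : 'rV[R]_n, forall (z : R) l,
    let y := W + z *: u in
    let s := pair (y *m H) y in
    let k := s * pair (W *m A) y - 2 * pair (y *m A) y in
    4 * s * (a 0 l + b 0 l * z + c 0 l * z ^+ 2)
      = 2 * k * (y *m H) 0 l - s * k * (W *m H) 0 l - s ^+ 2 * (curl A y) 0 l) ->
  A = 0.
Proof.
move=> Hs Hpos W1 AW quad.
have sE u z : pair (W *m H) u = 0 ->
    pair ((W + z *: u) *m H) (W + z *: u) = 1 + pair (u *m H) u * z ^+ 2.
  move=> Wu; rewrite mulmxDl -scalemxAl !pairDl !pairDr !pairZl !pairZr W1 Wu.
  by rewrite (pair_sym u W Hs) Wu; ring.
have normal u : pair (W *m H) u = 0 -> pair (W *m A) u = 0 /\ pair (u *m A) u = 0.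
  move=> Wu; have [->|u0] := eqVneq u 0; first by rewrite mul0mx !pair0r.
  have [a [b [c abc]]] := quad u Wu.
  set m := pair (u *m H) u; have m0 : 0 < m by exact: Hpos.
  pose al := pair (W *m A) u; pose be := pair (u *m A) u.
  (* The equation paired with [W], with [s = 1 + m z^2] expanded. *)
  have /quartic_coefs_eq0[] : forall z,
      4 * pair a W + 4 * pair b W * z
      + (4 * pair c W + 4 * m * pair a W + 2 * be) * z ^+ 2
      + (4 * m * pair b W - 4 * m * al) * z ^+ 3
      + (4 * m * pair c W - 2 * m * be) * z ^+ 4 = 0.
    move=> z; have := abc z; rewrite /= sE// -/m.
    set y := W + z *: u; set s := 1 + _; set k := _ - _ => E.
    have kE : k = s * (z * al) - 2 * (z * al + z ^+ 2 * be).
      rewrite /k /y mulmxDl -scalemxAl !pairDl !pairDr !pairZl !pairZr !AW -/al -/be.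
      ring.
    have : (4 * s) *: (a + z *: b + z ^+ 2 *: c)
       = (2 * k) *: (y *m H) - (s * k) *: (W *m H) - s ^+ 2 *: curl A y.
      apply/rowP => l; have := E l; rewrite !mxE => <-; ring.
    move=> /(congr1 (pair^~ W)).
    have NE x : - x = (-1) *: x :> 'rV[R]_n by rewrite scaleN1r.
    rewrite /curl !NE !(pairDl, pairZl) AW -pair_mul W1.
    rewrite (pair_sym y W Hs) /y !(pairDr, pairZr) Wu W1 AW -/al kE /s => E'.
    rewrite -[RHS](subrr (4 * (1 + m * z ^+ 2) * (pair a W + z * pair b W + z ^+ 2
        * pair c W))).
    rewrite {2}E'; ring.
  rewrite -/al -/be => e0 e1 e2 e3 e4.
  have m0' : m != 0 by rewrite gt_eqF.
  have pa : pair a W = 0 by lra.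
  have pb : pair b W = 0 by lra.
  have pc : pair c W = - be / 2 by rewrite pa mulr0 addr0 in e2; lra.
  rewrite pb in e3; rewrite pc in e4.
  by split; apply: (mulfI m0'); rewrite mulr0; lra.
have tangent u : pair (W *m H) u = 0 -> u *m A = u *m A^T.
  move=> Wu; have [->|u0] := eqVneq u 0; first by rewrite !mul0mx.
  have [a [b [c abc]]] := quad u Wu; have [al0 be0] := normal u Wu.
  set m := pair (u *m H) u; have m0 : 0 < m by exact: Hpos.
  apply/rowP => l; apply/eqP; rewrite -subr_eq0; apply/eqP.
  pose g := (W *m A) 0 l - (W *m A^T) 0 l.
  set de := LHS.
  have /quartic_coefs_eq0[] : forall z,
      (4 * a 0 l + g) + (4 * b 0 l + de) * z + (4 * c 0 l + m * g) * z ^+ 2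
      + m * de * z ^+ 3 + 0 * z ^+ 4 = 0.
    move=> z; have := abc z l; rewrite /= sE// -/m.
    set y := W + z *: u.
    have -> : (1 + m * z ^+ 2) * pair (W *m A) y - 2 * pair (y *m A) y = 0.
      rewrite /y mulmxDl -scalemxAl !(pairDl, pairDr, pairZl, pairZr) !AW al0 be0.
      ring.
    rewrite !(mulr0, mul0r) subr0 sub0r => E.
    have s0 : 1 + m * z ^+ 2 != 0.
      by rewrite gt_eqF// ltr_pwDl// mulr_ge0 ?sqr_ge0// ltW.
    apply: (mulfI s0); rewrite mulr0.
    have cE : curl A y 0 l = g + z * de.
      by rewrite /curl /y /g /de !mulmxDl -!scalemxAl !mxE; ring.
    rewrite cE in E.
    rewrite -[RHS](subrr (4 * (1 + m * z ^+ 2) * (a 0 l + b 0 l * z + c 0 l * z ^+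
        2))).
    rewrite {2}E; ring.
  move=> _ _ _ e3 _; apply: (mulfI (lt0r_neq0 m0)); by rewrite mulr0.
have split_W v : exists2 u, pair (W *m H) u = 0 & v = pair (W *m H) v *: W + u.
  exists (v - pair (W *m H) v *: W); last by rewrite addrC subrK.
  by rewrite -scaleN1r scalerA pairDr pairZr W1; ring.
have WA : W *m A = 0.
  apply/rowP => j; rewrite [RHS]mxE -pair_delta.
  have [u Wu ->] := split_W (delta_mx 0 j).
  by rewrite pairDr pairZr AW mulr0 add0r; case: (normal u Wu).
have WAT : W *m A^T = 0.
  by apply/rowP => j; rewrite [RHS]mxE -pair_delta pair_mul trmxK AW.
have symA v : v *m A = v *m A^T.
  have [u Wu ->] := split_W v.
  by rewrite !mulmxDl -!scalemxAl WA WAT (tangent u Wu).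
have altA v : pair (v *m A) v = 0.
  have [u Wu ->] := split_W v.
  rewrite !mulmxDl -!scalemxAl WA scaler0 add0r pairDr pairZr AW mulr0 add0r.
  by case: (normal u Wu).
apply/matrixP => i j; rewrite [RHS]mxE.
have pE u v : pair (u *m A) v = 0.
  have := altA (u + v); rewrite mulmxDl pairDl !pairDr !altA.
  have -> : pair (v *m A) u = pair (u *m A) v by rewrite pair_mul -symA.
  by lra.
by have := pE (delta_mx 0 i) (delta_mx 0 j); rewrite pair_delta -rowE mxE.
Qed.

End Pairing.

(** * Fibre derivatives of the Kropina energy *)

Section LinearAndQuadraticForms.
Variables (R : realType) (n : nat).
Implicit Types (Om : set 'rV[R]_n) (xi : 'rV[R]_n) (B : 'M[R]_n).

Lemma rational_linear Om B l : rational_on Om (fun y => (y *m B) 0 l).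
Proof.
apply: (@rational_ext _ _ _ (fun y => \sum_i y 0 i * B i l)) => [|y _];
    last by rewrite mxE.
by apply: rational_sum => i; apply: rational_mul;
    [exact: rational_coord | exact: rational_cst].
Qed.

Lemma rational_pair Om xi : rational_on Om (pair xi).
Proof.
by apply: rational_sum => i; apply: rational_mul;
    [exact: rational_cst | exact: rational_coord].
Qed.

Lemma rational_quad Om B : rational_on Om (fun y => pair (y *m B) y).
Proof.
by apply: rational_sum => i; apply: rational_mul;
    [exact: rational_linear | exact: rational_coord].
Qed.

Lemma is_derive_pair (xi y e : 'rV[R]_n) : is_derive y e (pair xi) (pair xi e).
Proof. by apply: is_derive_linear => r v; rewrite pairDr pairZr. Qed.

Lemma is_derive_quad (S : 'M[R]_n) y e : S^T = S ->
  is_derive y e (fun v => pair (v *m S) v) (2 * pair (y *m S) e).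
Proof.
move=> Ss; have dl i : is_derive y e (fun v => (v *m S) 0 i) ((e *m S) 0 i).
  by apply: (@is_derive_linear _ _ (fun v => (v *m S) 0 i)) => r v;
      rewrite mulmxDl -scalemxAl !mxE.
have dr i : is_derive y e (fun v => v 0 i) (e 0 i).
  by apply: (@is_derive_linear _ _ (fun v => v 0 i)) => r v; rewrite !mxE.
have := is_derive_wsum (fun=> 1) (fun i => is_deriveM (dl i) (dr i)).
rewrite [X in is_derive _ _ X](_ : _ = fun v => pair (v *m S) v); last first.
  by apply/funext => v; apply: eq_bigr => i _; rewrite mul1r.
move=> d; apply: is_derive_eq d _.
rewrite mulr_natl mulr2n {2}(pair_sym y e Ss) /pair -big_split/=.
by apply: eq_bigr => i _; rewrite mul1r /GRing.scale/= [y 0 i * _]mulrC.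
Qed.

End LinearAndQuadraticForms.

Section FibreDerivatives.
Variables (R : realType) (n : nat).
Variables (H : 'M[R]_n) (W : 'rV[R]_n).
Hypothesis Hsym : H^T = H.
Implicit Types (y v : 'rV[R]_n).

Let s y := pair (y *m H) y.
Let t y := pair (W *m H) y.

(** The square of [F = s / (2 t)] and its partial derivatives with respect to
    [s] and [t]. *)
Definition kropina_sq y : R := (s y / (2 * t y)) ^+ 2.
Definition kropina_ds y : R := s y / (2 * t y ^+ 2).
Definition kropina_dt y : R := - (s y ^+ 2 / (2 * t y ^+ 3)).

Lemma is_derive_kropina_sq y l : t y != 0 ->
  is_derive y (delta_mx 0 l) kropina_sq
    (kropina_ds y * (2 * (y *m H) 0 l) + kropina_dt y * (W *m H) 0 l).
Proof.
move=> t0; have t20 : 2 * t y != 0 by rewrite mulf_neq0.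
have dq := is_derive_quot t20 (is_derive_quad y (delta_mx 0 l) Hsym)
  (is_derive_scale 2 (is_derive_pair (W *m H) y (delta_mx 0 l))).
apply: is_derive_eq (is_derive_expn 2 dq) _.
rewrite /kropina_ds /kropina_dt !pair_delta -/(s y) -/(t y) /=.
by field.
Qed.

Lemma is_derive_kropina_ds y l : t y != 0 ->
  is_derive y (delta_mx 0 l) kropina_ds
    ((y *m H) 0 l / t y ^+ 2 - s y * (W *m H) 0 l / t y ^+ 3).
Proof.
move=> t0; have t20 : 2 * t y ^+ 2 != 0 by rewrite mulf_neq0// expf_neq0.
have dq := is_derive_quot t20 (is_derive_quad y (delta_mx 0 l) Hsym)
  (is_derive_scale 2 (is_derive_expn 2 (is_derive_pair (W *m H) y (delta_mx 0 l)))).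
apply: is_derive_eq dq _.
rewrite !pair_delta -/(s y) -/(t y) /=.
by field.
Qed.

Lemma is_derive_kropina_dt y l : t y != 0 ->
  is_derive y (delta_mx 0 l) kropina_dt
    (- 2 * s y * (y *m H) 0 l / t y ^+ 3
     + 3 * s y ^+ 2 * (W *m H) 0 l / (2 * t y ^+ 4)).
Proof.
move=> t0; have t20 : 2 * t y ^+ 3 != 0 by rewrite mulf_neq0// expf_neq0.
have dq := is_derive_quot t20
  (is_derive_expn 2 (is_derive_quad y (delta_mx 0 l) Hsym))
  (is_derive_scale 2 (is_derive_expn 3 (is_derive_pair (W *m H) y (delta_mx 0 l)))).
apply: is_derive_eq (is_deriveN dq) _.
rewrite !pair_delta -/(s y) -/(t y) /=.
by field.
Qed.

(** The differentiated function is the derivative of [F^2] in a base direction,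
    for which [S] and [T] are the derivatives of the metric and of the lowered
    field. *)
Lemma is_derive_kropina_form (S : 'M[R]_n) (T : 'rV[R]_n) y l :
  S^T = S -> t y != 0 ->
  is_derive y (delta_mx 0 l)
    (fun v => kropina_ds v * pair (v *m S) v + kropina_dt v * pair T v)
    (((y *m H) 0 l / t y ^+ 2 - s y * (W *m H) 0 l / t y ^+ 3) * pair (y *m S) y
     + kropina_ds y * (2 * (y *m S) 0 l)
     + (- 2 * s y * (y *m H) 0 l / t y ^+ 3
         + 3 * s y ^+ 2 * (W *m H) 0 l / (2 * t y ^+ 4)) * pair T y
     + kropina_dt y * T 0 l).
Proof.
move=> Ss t0.
apply: is_derive_eq (is_deriveD
  (is_deriveM (is_derive_kropina_ds l t0) (is_derive_quad y (delta_mx 0 l) Ss))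
  (is_deriveM (is_derive_kropina_dt l t0) (is_derive_pair T y (delta_mx 0 l)))) _.
by rewrite /GRing.scale/= !pair_delta; ring.
Qed.

Lemma open_kropina_cone : open [set y | 0 < t y].
Proof.
have ct : continuous t.
  move=> y; apply: differentiable_continuous.
  rewrite (_ : t = \sum_(i < n) (fun v => (W *m H) 0 i * v 0 i)); last first.
    by apply/funext => v; rewrite fct_sumE.
  apply: differentiable_sum => i; apply: differentiableM => //.
  exact: differentiable_coord.
rewrite (_ : [set y | _] = t @^-1` [set r | 0 < r])//.
by apply: open_comp; [move=> y _; exact: ct | exact: open_gt].
Qed.

Lemma pderiv2_kropina_sq y i j : 0 < t y ->
  pderiv j (pderiv i kropina_sq) y
    = 2 * (y *m H) 0 i * (y *m H) 0 j / t y ^+ 2 + s y * H i j / t y ^+ 2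
      - 2 * s y * ((y *m H) 0 i * (W *m H) 0 j + (y *m H) 0 j * (W *m H) 0 i)
          / t y ^+ 3
      + 3 * s y ^+ 2 * (W *m H) 0 i * (W *m H) 0 j / (2 * t y ^+ 4).
Proof.
move=> ty; have t0 : t y != 0 by rewrite gt_eqF.
rewrite (@eq_on_pderiv _ _ [set y | 0 < t y] _
  (fun v => kropina_ds v * (2 * (v *m H) 0 i) + kropina_dt v * (W *m H) 0 i))//.
- have dl : is_derive y (delta_mx 0 j) (fun v => (v *m H) 0 i) (H i j).
    have -> : H i j = ((delta_mx 0 j : 'rV[R]_n) *m H) 0 i by rewrite -rowE mxE
        -[in LHS]Hsym mxE.
    by apply: (@is_derive_linear _ _ (fun v => (v *m H) 0 i)) => r v;
        rewrite mulmxDl -scalemxAl !mxE.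
  have [_ d] := is_deriveD
    (is_deriveM (is_derive_kropina_ds j t0) (is_derive_scale 2 dl))
    (is_deriveM (is_derive_kropina_dt j t0) (is_derive_cst ((W *m H) 0 i) y
        (delta_mx 0 j))).
  rewrite /pderiv d /GRing.scale/= /kropina_ds /kropina_dt /cst; field.
  exact: t0.
- exact: open_kropina_cone.
- move=> v tv; have tv0 : t v != 0 by rewrite gt_eqF.
  by rewrite /pderiv; have [_ ->] := is_derive_kropina_sq i tv0.
Qed.

End FibreDerivatives.

(** * The navigation metric and field in a chart *)

Section ChartGeometry.
Variables (R : realType) (n : nat) (M : topologicalType).
Variables (A : smooth_manifold R n M) (h : riemannian_metric A).
Variables (W : vector_field A) (c : A) (x : 'rV[R]_n).
Hypothesis Ux : chart_img c x.
Implicit Types (u v y : 'rV[R]_n) (i j k l : 'I_n).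

Let H : 'M[R]_n := h c x.

Lemma metric_pair_sym : H^T = H.
Proof. exact: (Defs.metric_sym h Ux). Qed.

Lemma metric_pair_gt0 u : u != 0 -> 0 < pair (u *m H) u.
Proof. by move=> u0; rewrite -qformE; exact: metric_posdef. Qed.

Lemma metric_unitmx : H \in unitmx.
Proof.
rewrite -row_free_unit; apply: inj_row_free => v vH.
by apply/eqP; apply/negPn/negP => /metric_pair_gt0; rewrite vH pair0l ltxx.
Qed.

Definition dmetric k : 'M[R]_n := \matrix_(i, j) pderiv k (fun z => h c z i j) x.
Lemma dmetricE k i j : dmetric k i j = pderiv k (fun z => h c z i j) x.
Proof. by rewrite mxE. Qed.

Definition dfield k : 'rV[R]_n := \row_i pderiv k (fun z => W c z 0 i) x.
(** The derivative of the covector [h(W, -)], by the product rule. *)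
Definition dlower k : 'rV[R]_n := dfield k *m H + W c x *m dmetric k.
Definition nabla : 'M[R]_n := \matrix_(k, i)
  (pderiv k (fun z => W c z 0 i) x
   + \sum_(m < n) christoffel h c x k i m * W c x 0 m).

Lemma is_derive_metric k i j :
  is_derive x (delta_mx 0 k) (fun z => h c z i j) (dmetric k i j).
Proof.
rewrite mxE; apply: derivableP; have [_ /(_ k)[d _]] := metric_smooth h c i j 1.
exact: d.
Qed.

Lemma is_derive_field k i :
  is_derive x (delta_mx 0 k) (fun z => W c z 0 i) (dfield k 0 i).
Proof.
rewrite mxE; apply: derivableP; have [_ /(_ k)[d _]] := field_smooth W c i 1.
exact: d.
Qed.

Lemma open_chart_img : open (chart_img c).
Proof. exact: chart_img_open. Qed.

Lemma metric_entry_sym z i j : chart_img c z -> h c z i j = h c z j i.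
Proof. by move=> Uz; rewrite -[in LHS](Defs.metric_sym h Uz) mxE. Qed.

Lemma dmetric_sym k : (dmetric k)^T = dmetric k.
Proof.
apply/matrixP => i j; rewrite !mxE; apply: eq_on_pderiv open_chart_img Ux _.
by move=> z; exact: metric_entry_sym.
Qed.

Lemma christoffel_sym j i k : christoffel h c x j i k = christoffel h c x k i j.
Proof.
rewrite /christoffel; congr (_ * _); apply: eq_bigr => l _; congr (_ * _).
have E a b m : pderiv m (fun z => h c z a b) x = pderiv m (fun z => h c z b a) x.
  by apply: eq_on_pderiv open_chart_img Ux _ => z; exact: metric_entry_sym.
by rewrite (E k j l) (E l k j) (E j l k) (addrC (pderiv k _ _)).
Qed.

(** Christoffel symbols of the first kind. *)
Lemma lower_christoffel l j k :
  2 * \sum_i H l i * christoffel h c x j i k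
    = dmetric j l k + dmetric k j l - dmetric l j k.
Proof.
pose e : 'cV[R]_n := \col_m (dmetric j m k + dmetric k j m - dmetric m j k).
have -> : dmetric j l k + dmetric k j l - dmetric l j k = (H *m (invmx H *m e)) l 0.
  by rewrite mulKVmx ?metric_unitmx// [RHS]mxE.
rewrite mxE mulr_sumr; apply: eq_bigr => i _; rewrite /christoffel.
rewrite mulrCA; congr (_ * _); rewrite mulrA mulfV// mul1r mxE.
by apply: eq_bigr => m _; congr (_ * _); rewrite [RHS]mxE; congr (_ + _ - _);
    rewrite [RHS]dmetricE.
Qed.

Definition rspray y : 'rV[R]_n := \row_i riemannian_spray h c x y i.

Lemma lower_rspray y l :
  4 * (rspray y *m H) 0 l
    = 2 * (\sum_k y 0 k * (y *m dmetric k) 0 l) - pair (y *m dmetric l) y.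
Proof.
have -> : (rspray y *m H) 0 l
    = 2^-1 * \sum_j \sum_k (\sum_i H l i * christoffel h c x j i k) * y 0 j * y 0 k.
  rewrite mxE.
  transitivity (2^-1 * \sum_i \sum_j \sum_k H l i * christoffel h c x j i k * y 0 j
      * y 0 k).
    rewrite mulr_sumr; apply: eq_bigr => i _; rewrite mxE /riemannian_spray.
    rewrite -mulrA; congr (_ * _); rewrite mulr_suml; apply: eq_bigr => j _.
    rewrite mulr_suml; apply: eq_bigr => k _.
    by rewrite (metric_entry_sym i l Ux); ring.
  congr (_ * _); rewrite exchange_big/=; apply: eq_bigr => j _.
  rewrite exchange_big/=; apply: eq_bigr => k _.
  by rewrite !mulr_suml.
have dS m a b : dmetric m a b = dmetric m b a by rewrite -{1}dmetric_sym mxE.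
transitivity (\sum_j \sum_k (dmetric j l k + dmetric k j l - dmetric l j k) * y 0 j
    * y 0 k).
  rewrite mulrA (_ : 4 * 2^-1 = 2); last by field.
  rewrite mulr_sumr; apply: eq_bigr => j _; rewrite mulr_sumr; apply: eq_bigr => k _.
  by rewrite -lower_christoffel; ring.
have S1 : \sum_j \sum_k dmetric j l k * y 0 j * y 0 k = \sum_k y 0 k * (y *m
    dmetric k) 0 l.
  apply: eq_bigr => j _; rewrite mxE mulr_sumr; apply: eq_bigr => k _.
  by rewrite dS; ring.
have S2 : \sum_j \sum_k dmetric k j l * y 0 j * y 0 k = \sum_k y 0 k * (y *m
    dmetric k) 0 l.
  rewrite exchange_big; apply: eq_bigr => k _; rewrite mxE mulr_sumr.
  by apply: eq_bigr => j _; ring.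
have S3 : \sum_j \sum_k dmetric l j k * y 0 j * y 0 k = pair (y *m dmetric l) y.
  by rewrite -qformE.
rewrite -S3 mulr_natl mulr2n -[in X in X + _ - _]S1 -S2 -big_split -sumrB/=.
apply: eq_bigr => j _; rewrite -big_split -sumrB/=; apply: eq_bigr => k _.
ring.
Qed.

(** Horizontal constancy of [h(y, y)] in the direction [y]. *)
Lemma rspray_energy y :
  4 * pair (y *m H) (rspray y) = \sum_k y 0 k * pair (y *m dmetric k) y.
Proof.
rewrite (pair_sym _ _ metric_pair_sym).
transitivity (\sum_l (4 * (rspray y *m H) 0 l) * y 0 l).
  by rewrite mulr_sumr; apply: eq_bigr => l _; rewrite mulrA.
under eq_bigr do rewrite lower_rspray mulrBl.
rewrite sumrB [X in _ - X](_ : _ = \sum_k y 0 k * pair (y *m dmetric k) y);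
    last first.
  by apply: eq_bigr => k _; rewrite mulrC.
rewrite [X in X - _](_ : _ = 2 * \sum_k y 0 k * pair (y *m dmetric k) y); last first.
  rewrite mulr_sumr; under eq_bigr do rewrite -mulrA mulr_suml mulr_sumr.
  rewrite exchange_big/=; apply: eq_bigr => k _; rewrite /pair !mulr_sumr.
  by apply: eq_bigr => l _; ring.
by rewrite mulr_natl mulr2n addrK.
Qed.

(** Lowering the index commutes with covariant differentiation, because the
    metric is parallel. *)
Lemma lower_nabla k l :
  (nabla *m H) k l
    = dlower k 0 l - \sum_i christoffel h c x k i l * (W c x *m H) 0 i.
Proof.
have dS m a b : dmetric m a b = dmetric m b a by rewrite -{1}dmetric_sym mxE.
pose G a := \sum_i H a i * christoffel h c x k i l.
pose G' m := \sum_i H l i * christoffel h c x k i m.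
have -> : \sum_i christoffel h c x k i l * (W c x *m H) 0 i = \sum_m W c x 0 m * G m.
  under eq_bigr do rewrite mxE mulr_sumr.
  rewrite exchange_big/=; apply: eq_bigr => m _; rewrite mulr_sumr.
  by apply: eq_bigr => i _; ring.
have -> : (nabla *m H) k l = (dfield k *m H) 0 l + \sum_m W c x 0 m * G' m.
  rewrite !mxE; under eq_bigr do rewrite !mxE mulrDl mulr_suml.
  rewrite big_split/=; congr (_ + _); first by apply: eq_bigr => i _; rewrite mxE.
  rewrite exchange_big/=; apply: eq_bigr => m _; rewrite mulr_sumr.
  by apply: eq_bigr => i _; rewrite (metric_entry_sym i l Ux); ring.
rewrite /dlower [X in _ = X - _]mxE -addrA; congr (_ + _).
rewrite [X in _ = X - _]mxE -sumrB; apply: eq_bigr => m _; rewrite -mulrBr;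
    congr (_ * _).
have e1 : 2 * G m = _ := lower_christoffel m k l.
have e2 : 2 * G' m = _ := lower_christoffel l k m.
have two0 : (2 : R) != 0 by [].
apply: (mulfI two0); rewrite e2 mulrBr e1; move: dmetric dS => d dS.
by rewrite (dS m k l) (dS k l m) (dS l k m); ring.
Qed.

Definition dlower_mx : 'M[R]_n := \matrix_(k, l) dlower k 0 l.

Lemma nabla_energy y :
  pair (y *m (nabla *m H)) y
    = pair (y *m dlower_mx) y - 2 * pair (W c x *m H) (rspray y).
Proof.
rewrite -!qformE /qform.
have -> : 2 * pair (W c x *m H) (rspray y)
    = \sum_k \sum_l (\sum_i christoffel h c x k i l * (W c x *m H) 0 i) * y 0 k * y
        0 l.
  under [RHS]eq_bigr do under eq_bigr do rewrite !mulr_suml.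
  under [RHS]eq_bigr do rewrite exchange_big/=.
  rewrite exchange_big/= mulr_sumr; apply: eq_bigr => i _.
  rewrite [rspray y 0 i]mxE /riemannian_spray mulrCA (mulrA 2) mulfV// mul1r.
  rewrite mulr_sumr; apply: eq_bigr => k _; rewrite mulr_sumr.
  by apply: eq_bigr => l _; ring.
rewrite -sumrB; apply: eq_bigr => k _; rewrite -sumrB; apply: eq_bigr => l _.
by rewrite lower_nabla [dlower_mx k l]mxE; ring.
Qed.

(** The Levi-Civita connection is torsion free. *)
Lemma curl_nabla y :
  curl (nabla *m H) y = curl dlower_mx y.
Proof.
rewrite /curl -!mulmxBr; congr (_ *m _); apply/matrixP => k l.
rewrite [LHS]mxE [RHS]mxE [X in _ + X = _]mxE [X in _ = _ + X]mxE.
rewrite [(_ *m _)^T _ _]mxE [dlower_mx^T _ _]mxE !lower_nabla.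
rewrite [dlower_mx k l]mxE [dlower_mx l k]mxE.
rewrite (_ : \sum_i christoffel h c x l i k * (W c x *m H) 0 i
  = \sum_i christoffel h c x k i l * (W c x *m H) 0 i); first by ring.
by apply: eq_bigr => i _; rewrite christoffel_sym.
Qed.

Lemma is_derive_lower k l :
  is_derive x (delta_mx 0 k) (fun z => (W c z *m h c z) 0 l) (dlower k 0 l).
Proof.
have := is_derive_wsum (fun=> 1)
  (fun i => is_deriveM (is_derive_field k i) (is_derive_metric k i l)).
rewrite [X in is_derive _ _ X](_ : _ = fun z => (W c z *m h c z) 0 l); last first.
  by apply/funext => z; rewrite mxE; apply: eq_bigr => i _; rewrite mul1r.
move=> d; apply: is_derive_eq d _.
rewrite [RHS]mxE [X in _ = X + _]mxE [X in _ = _ + X]mxE -big_split.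
by apply: eq_bigr => i _; rewrite /GRing.scale/= mul1r; ring.
Qed.

Section UnitField.
Hypothesis unitW : forall z, chart_img c z -> pair (W c z *m h c z) (W c z) = 1.

(** A field of constant length is orthogonal to its covariant derivatives. *)
Lemma nabla_unit u : pair (u *m (nabla *m H)) (W c x) = 0.
Proof.
have dS m a b : dmetric m a b = dmetric m b a by rewrite -{1}dmetric_sym mxE.
have unit_k k : pair (dlower k) (W c x) + pair (W c x *m H) (dfield k) = 0.
  have := is_derive_wsum (fun=> 1)
    (fun i => is_deriveM (is_derive_lower k i) (is_derive_field k i)).
  rewrite [X in is_derive _ _ X](_ : _ = fun z => pair (W c z *m h c z) (W c z));
      last first.
    by apply/funext => z; apply: eq_bigr => i _; rewrite mul1r.
  move=> /(eq_on_is_derive open_chart_img Ux unitW)[_].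
  rewrite derive_cst => E; rewrite [RHS]E [LHS]addrC /pair -big_split.
  by apply: eq_bigr => i _; rewrite /GRing.scale/= mul1r; ring.
suff BW : W c x *m (nabla *m H)^T = 0 by rewrite pair_mul BW pair0l.
apply/rowP => k; rewrite [RHS]mxE mxE.
pose g := \sum_l \sum_i christoffel h c x k i l * (W c x *m H) 0 i * W c x 0 l.
have e1 : \sum_l W c x 0 l * (nabla *m H)^T l k = pair (dlower k) (W c x) - g.
  rewrite -sumrB; apply: eq_bigr => l _; rewrite mxE lower_nabla mulrC mulrBl.
  by rewrite mulr_suml.
have e2 : \sum_l W c x 0 l * (nabla *m H)^T l k = pair (W c x *m H) (dfield k) + g.
  transitivity (pair (W c x *m H) (row k nabla)).
    rewrite (pair_sym _ _ metric_pair_sym) -row_mul; apply: eq_bigr => l _.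
    by rewrite !mxE mulrC.
  rewrite /g exchange_big/= -big_split; apply: eq_bigr => i _.
  rewrite /= !mxE mulrDr mulr_sumr; congr (_ + _).
  by apply: eq_bigr => l _; ring.
have := unit_k k; rewrite -/H in e1 e2 *.
move: (\sum_l _) e1 e2 => r e1 e2; lra.
Qed.
End UnitField.

End ChartGeometry.

(** * The spray of a Kropina metric *)

Section KropinaSpray.
Variables (R : realType) (n : nat) (M : topologicalType).
Variables (A : smooth_manifold R n M) (h : riemannian_metric A).
Variables (W : vector_field A) (F : A -> 'rV[R]_n -> 'rV[R]_n -> R) (c : A).
Hypothesis unitW : forall z, chart_img c z -> pair (W c z *m h c z) (W c z) = 1.
Hypothesis FE : forall z v, chart_img c z ->
  F c z v = pair (v *m h c z) v / (2 * pair (W c z *m h c z) v).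
Variable x : 'rV[R]_n.
Hypothesis Ux : chart_img c x.
Implicit Types (u v y : 'rV[R]_n) (i j k l : 'I_n).

Let H : 'M[R]_n := h c x.
Let Wx : 'rV[R]_n := W c x.
Let Hsym : H^T = H := metric_pair_sym h Ux.
Let s y := pair (y *m H) y.
Let t y := pair (Wx *m H) y.

Lemma pderiv_base_kropina k v : t v != 0 ->
  pderiv k (fun z => F c z v ^+ 2) x
    = kropina_ds H Wx v * pair (v *m dmetric h c x k) v
      + kropina_dt H Wx v * pair (dlower h W c x k) v.
Proof.
move=> t0.
rewrite (@eq_on_pderiv _ _ (chart_img c) _
  (fun z => (pair (v *m h c z) v / (2 * pair (W c z *m h c z) v)) ^+ 2))//;
      first last.
- by move=> z Uz; rewrite FE.
- exact: open_chart_img.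
have dS : is_derive x (delta_mx 0 k) (fun z => pair (v *m h c z) v)
    (pair (v *m dmetric h c x k) v).
  have := is_derive_wsum (v 0) (fun j => is_derive_wsum (v 0) (fun i =>
      is_derive_metric h Ux k i j)).
  rewrite [X in is_derive _ _ X](_ : _ = fun z => pair (v *m h c z) v); last first.
    by apply/funext => z; apply: eq_bigr => j _; rewrite mxE mulrC.
  move=> d; apply: is_derive_eq d _.
  by apply: eq_bigr => j _; rewrite [in RHS]mxE mulrC.
have dT : is_derive x (delta_mx 0 k) (fun z => 2 * pair (W c z *m h c z) v)
    (2 * pair (dlower h W c x k) v).
  apply: is_derive_scale.
  have := is_derive_wsum (v 0) (fun j => is_derive_lower h W Ux k j).
  rewrite [X in is_derive _ _ X](_ : _ = fun z => pair (W c z *m h c z) v);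
      last first.
    by apply/funext => z; apply: eq_bigr => j _; rewrite mulrC.
  move=> d; apply: is_derive_eq d _.
  by apply: eq_bigr => j _; rewrite mulrC.
have t20 : 2 * pair (W c x *m h c x) v != 0 by rewrite mulf_neq0.
have [_] := is_derive_expn 2 (is_derive_quot t20 dS dT).
rewrite /pderiv => ->; rewrite /kropina_ds /kropina_dt -/(s v) -/(t v) /=.
by field.
Qed.

Lemma fundamental_tensorE y i j : 0 < t y ->
  2 * fundamental_tensor F c x y i j
    = 2 * (y *m H) 0 i * (y *m H) 0 j / t y ^+ 2 + s y * H i j / t y ^+ 2
      - 2 * s y * ((y *m H) 0 i * (Wx *m H) 0 j + (y *m H) 0 j * (Wx *m H) 0 i)
          / t y ^+ 3
      + 3 * s y ^+ 2 * (Wx *m H) 0 i * (Wx *m H) 0 j / (2 * t y ^+ 4).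
Proof.
move=> ty; transitivity (pderiv j (pderiv i (kropina_sq H Wx)) y).
  rewrite [fundamental_tensor _ _ _ _ _ _]mxE mulrA mulfV ?pnatr_eq0// mul1r.
  have -> : (fun v => F c x v ^+ 2) = kropina_sq H Wx.
    by apply/funext => v; rewrite FE.
  by [].
exact: pderiv2_kropina_sq.
Qed.

Lemma fundamental_tensor_mul y v l : 0 < t y ->
  let p := pair (y *m H) v in let q := pair (Wx *m H) v in
  2 * \sum_i fundamental_tensor F c x y l i * v 0 i
    = 2 * p * (y *m H) 0 l / t y ^+ 2 + s y * (v *m H) 0 l / t y ^+ 2
      - 2 * s y * (p * (Wx *m H) 0 l + q * (y *m H) 0 l) / t y ^+ 3
      + 3 * s y ^+ 2 * q * (Wx *m H) 0 l / (2 * t y ^+ 4).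
Proof.
move=> ty p q.
rewrite mulr_sumr; under eq_bigr do rewrite mulrA fundamental_tensorE//.
move: (s y) (t y) => sy ty'.
pose a := 2 * (y *m H) 0 l / ty' ^+ 2 - 2 * sy * (Wx *m H) 0 l / ty' ^+ 3.
pose b := 3 * sy ^+ 2 * (Wx *m H) 0 l / (2 * ty' ^+ 4) - 2 * sy * (y *m H) 0 l /
    ty' ^+ 3.
transitivity (a * p + sy / ty' ^+ 2 * (v *m H) 0 l + b * q).
  rewrite /p /q [(v *m H) 0 l]mxE !mulr_sumr -!big_split/=; apply: eq_bigr => i _.
  rewrite /H (metric_entry_sym h l i Ux) -/H /a /b; ring.
by rewrite /a /b; ring.
Qed.

Lemma kropina_s_gt0 y : 0 < t y -> 0 < s y.
Proof.
move=> ty; apply: (metric_pair_gt0 h Ux).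
by apply: contraTN ty => /eqP ->; rewrite /t pair0r ltxx.
Qed.

(** An element of the kernel solves the spray equation with zero right-hand
    side, whose only solution is zero. *)
Lemma fundamental_tensor_unit y : 0 < t y ->
  fundamental_tensor F c x y \in unitmx.
Proof.
move=> ty; rewrite -unitmx_tr -row_free_unit; apply: inj_row_free => v vg.
have s0 : s y != 0 by rewrite gt_eqF// kropina_s_gt0.
have t0 : t y != 0 by rewrite gt_eqF.
have E l : \sum_i fundamental_tensor F c x y l i * v 0 i = 0.
  transitivity ((v *m (fundamental_tensor F c x y)^T) 0 l); last by rewrite vg mxE.
  by rewrite [RHS]mxE; apply: eq_bigr => i _; rewrite [_^T _ _]mxE mulrC.
have vH l : 4 * s y * t y * (v *m H) 0 l = 0.
  rewrite (@spray_difference_solution _ _ H Wx y v 0 0 0 Hsym (unitW Ux) _ _ s0 t0).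
  - by rewrite [X in _ - _ * X]mxE !(mulr0, subrr, mul0r).
  - by rewrite pair0l.
  - by rewrite pair0l oppr0.
  - by move=> l'; rewrite -fundamental_tensor_mul// E [X in _ = _ - _ * X]mxE
      !mulr0 mul0r subrr.
have : v *m H = 0.
  apply/rowP => l; rewrite [RHS]mxE; apply: (mulfI (_ : 4 * s y * t y != 0)).
    by rewrite !mulf_neq0.
  by rewrite vH mulr0.
by move=> /(congr1 (mulmx^~ (invmx H))); rewrite mulmxK ?metric_unitmx// mul0mx.
Qed.

Definition kspray y : 'rV[R]_n := \row_i spray F c x y i.

Lemma kspray_eq y l : 0 < t y ->
  2 * (2 * \sum_i fundamental_tensor F c x y l i * kspray y 0 i)
  = (\sum_k pderiv l (fun v => pderiv k (fun z => F c z v ^+ 2) x) y * y 0 k)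
     - pderiv l (fun z => F c z y ^+ 2) x.
Proof.
move=> ty; set g := fundamental_tensor F c x y.
pose r : 'cV[R]_n := \col_l
  ((\sum_k pderiv l (fun v => pderiv k (fun z => F c z v ^+ 2) x) y * y 0 k)
     - pderiv l (fun z => F c z y ^+ 2) x).
have G i : kspray y 0 i = 4^-1 * (invmx g *m r) i 0.
  by rewrite mxE /spray; congr (_ * _); rewrite mxE; apply: eq_bigr => m _;
      rewrite [r _ _]mxE.
transitivity ((g *m (invmx g *m r)) l 0); last first.
  by rewrite mulKVmx ?fundamental_tensor_unit// mxE.
rewrite [RHS]mxE !mulr_sumr; apply: eq_bigr => i _; by rewrite G; field.
Qed.

(** Subtracting the contribution of the Riemannian spray from the spray equation
    leaves the equation solved by [spray_difference_solution]: the derivatives of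
    the metric cancel by [lower_rspray] and [rspray_energy], those of the lowered
    field combine into the covariant derivative by [nabla_energy] and
    [curl_nabla]. *)
Lemma kspray_difference y l : 0 < t y ->
  let N := nabla h W c x *m H in
  let k := s y * pair (Wx *m N) y - 2 * t y * pair (y *m N) y in
  4 * s y * t y * ((kspray y - rspray h c x y) *m H) 0 l
    = 2 * t y * k * (y *m H) 0 l - s y * k * (Wx *m H) 0 l
      - s y ^+ 2 * (curl N y) 0 l.
Proof.
move=> ty N kk.
have s0 : s y != 0 by rewrite gt_eqF// kropina_s_gt0.
have t0 : t y != 0 by rewrite gt_eqF.
apply: (spray_difference_solution Hsym (unitW Ux) _ _ s0 t0).
- by rewrite /curl pairDl -scaleN1r pairZl -pair_mul; ring.
- rewrite /curl pairDl -scaleN1r pairZl -pair_mul nabla_unit//.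
  by rewrite add0r mulN1r.
move=> {}l; rewrite -fundamental_tensor_mul//.
have -> : \sum_i fundamental_tensor F c x y l i * (kspray y - rspray h c x y) 0 i
    = \sum_i fundamental_tensor F c x y l i * kspray y 0 i
      - \sum_i fundamental_tensor F c x y l i * rspray h c x y 0 i.
  by rewrite -sumrB; apply: eq_bigr => i _; rewrite -mulrBr; congr (_ * _);
      rewrite [LHS]mxE [X in _ + X = _]mxE.
rewrite !mulrBr kspray_eq// fundamental_tensor_mul//.
rewrite (pderiv_base_kropina l t0).
pose c1 := (y *m H) 0 l / t y ^+ 2 - s y * (Wx *m H) 0 l / t y ^+ 3.
pose c2 := - 2 * s y * (y *m H) 0 l / t y ^+ 3
         + 3 * s y ^+ 2 * (Wx *m H) 0 l / (2 * t y ^+ 4).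
pose ds := kropina_ds H Wx y; pose dt := kropina_dt H Wx y.
pose T := dlower_mx h W c x.
have -> : \sum_k pderiv l (fun v => pderiv k (fun z => F c z v ^+ 2) x) y * y 0 k
    = c1 * (\sum_k y 0 k * pair (y *m dmetric h c x k) y)
      + 2 * ds * (\sum_k y 0 k * (y *m dmetric h c x k) 0 l)
      + c2 * pair (y *m T) y + dt * (y *m T) 0 l.
  have TE : pair (y *m T) y = \sum_k y 0 k * pair (dlower h W c x k) y.
    rewrite pair_mul pairC; apply: eq_bigr => k _; congr (_ * _).
    by rewrite [LHS]mxE; apply: eq_bigr => j _; rewrite mulrC 2!mxE.
  rewrite TE [(y *m T) 0 l]mxE !mulr_sumr -!big_split/=.
  apply: eq_bigr => k _; rewrite [T k l]mxE.
  rewrite (@eq_on_pderiv _ _ [set v | 0 < t v] _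
    (fun v => kropina_ds H Wx v * pair (v *m dmetric h c x k) v
      + kropina_dt H Wx v * pair (dlower h W c x k) v))//.
  - have [_] := is_derive_kropina_form Hsym (dlower h W c x k) l (dmetric_sym h Ux
      k) t0.
    by rewrite /pderiv => ->; rewrite -/(s y) -/(t y) -/c1 -/c2 -/ds -/dt; ring.
  - exact: open_kropina_cone.
  - by move=> v tv; apply: pderiv_base_kropina; rewrite gt_eqF.
have cE : (curl N y) 0 l = (y *m T) 0 l - pair (dlower h W c x l) y.
  rewrite /N /H (curl_nabla h W Ux) [LHS]mxE [X in _ + X = _]mxE -/T; congr (_ - _).
  by rewrite [LHS]mxE; apply: eq_bigr => j _; rewrite mulrC 2!mxE.
rewrite /N /H (nabla_energy h W Ux) -/N -/T cE -(rspray_energy h Ux).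
have := lower_rspray h Ux y l.
move: (\sum_k _) => q0 E; have {}E : q0 = 2 * (rspray h c x y *m H) 0 l
    + pair (y *m dmetric h c x l) y / 2 by move: E; rewrite -/H; lra.
rewrite E /c1 /c2 /ds /dt /kropina_ds /kropina_dt -/(s y) -/(t y) -/H.
move: (s y) t0 => sy t0; field; exact: t0.
Qed.

Lemma parallel_kspray y : nabla h W c x = 0 -> 0 < t y ->
  kspray y = rspray h c x y.
Proof.
move=> N0 ty; have s0 : s y != 0 by rewrite gt_eqF// kropina_s_gt0.
have t0 : t y != 0 by rewrite gt_eqF.
have DH : (kspray y - rspray h c x y) *m H = 0.
  apply/rowP => l; rewrite [RHS]mxE; apply: (mulfI (_ : 4 * s y * t y != 0)).
    by rewrite !mulf_neq0.
  rewrite kspray_difference// N0 mul0mx /curl trmx0 !mulmx0 !pair0l subrr.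
  by rewrite [X in _ - _ * X]mxE !(mulr0, mul0r, subrr).
apply/eqP; rewrite -subr_eq0; apply/eqP.
have := congr1 (mulmx^~ (invmx H)) DH.
by rewrite mulmxK ?metric_unitmx// mul0mx.
Qed.

Lemma rational_riemannian_spray (Om : set 'rV[R]_n) i : rational_on Om (fun y =>
    riemannian_spray h c x y i).
Proof.
apply: rational_mul; first exact: rational_cst.
apply: rational_sum => j; apply: rational_sum => k.
apply: rational_mul; last exact: rational_coord.
by apply: rational_mul; [exact: rational_cst | exact: rational_coord].
Qed.

(** The closed formula for the spray is raised with the inverse metric; its
    denominator [4 s t] has no zero in the cone. *)
Lemma rational_spray i : rational_on [set y | 0 < t y] (fun y => spray F c x y i).
Proof.
pose N := nabla h W c x *m H.
pose k y := s y * pair (Wx *m N) y - 2 * t y * pair (y *m N) y.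
pose num l y := 2 * t y * k y * (y *m H) 0 l - s y * k y * (Wx *m H) 0 l
      - s y ^+ 2 * (curl N y) 0 l.
pose d y := 4 * s y * t y.
have d0 y : 0 < t y -> d y != 0.
  by move=> ty; rewrite !mulf_neq0 ?gt_eqF// kropina_s_gt0.
apply: (@rational_ext _ _ _ (fun y => riemannian_spray h c x y i
   + \sum_l (d y)^-1 * num l y * invmx H l i)) => [|y /= ty]; last first.
  have -> : spray F c x y i = kspray y 0 i by rewrite mxE.
  have -> : riemannian_spray h c x y i = rspray h c x y 0 i by rewrite mxE.
  rewrite -[kspray y](subrK (rspray h c x y)) [RHS]mxE addrC; congr (_ + _).
  have -> : kspray y - rspray h c x y = (kspray y - rspray h c x y) *m H *m invmx H.
    by rewrite mulmxK ?metric_unitmx.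
  rewrite [RHS]mxE.
  apply: eq_bigr => l _; congr (_ * _).
  apply: (mulfI (d0 y ty)); rewrite mulrA mulfV ?d0// mul1r.
  exact: esym (kspray_difference l ty).
have rs := rational_quad [set y | 0 < t y] H.
have rt := rational_pair [set y | 0 < t y] (Wx *m H).
have rc r := rational_cst [set y | 0 < t y] r.
have rd : rational_on [set y | 0 < t y] d.
  by apply: rational_mul => //; apply: rational_mul.
have rk : rational_on [set y | 0 < t y] k.
  apply: rational_add; first by apply: rational_mul => //; exact: rational_pair.
  apply: rational_opp; apply: rational_mul; last exact: rational_quad.
  exact: rational_mul.
apply: rational_add; first exact: rational_riemannian_spray.
apply: rational_sum => l; apply: rational_mul => //.
apply: rational_mul; first exact: rational_inv rd d0.
apply: rational_add; first apply: rational_add.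
- apply: rational_mul; last exact: rational_linear.
  by apply: rational_mul => //; apply: rational_mul.
- by apply: rational_opp; apply: rational_mul => //; apply: rational_mul.
- apply: rational_opp; apply: rational_mul.
    apply: rational_ext (rational_mul rs rs) _ => y _; by rewrite expr2.
  apply: rational_ext (rational_linear _ (N - N^T) l) _ => y _.
  by rewrite /curl mulmxBr.
Qed.

Lemma pderiv_riemannian_spray i j :
  pderiv j (fun v => riemannian_spray h c x v i)
    = fun v => \sum_k christoffel h c x j i k * v 0 k.
Proof.
apply/funext => y; pose S : 'M[R]_n := \matrix_(a, b) christoffel h c x a i b.
have SE a b : S a b = christoffel h c x a i b by rewrite mxE.
have Ss : S^T = S by apply/matrixP => a b; rewrite mxE !SE christoffel_sym.
have -> : (fun v => riemannian_spray h c x v i) = fun v => 2^-1 * pair (v *m S) v.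
  apply/funext => v; rewrite /riemannian_spray -qformE; congr (_ * _).
  by apply: eq_bigr => a _; apply: eq_bigr => b _; rewrite SE.
have [_] := is_derive_scale 2^-1 (is_derive_quad y (delta_mx 0 j) Ss).
rewrite /pderiv => ->; rewrite mulrA mulVf// mul1r pair_delta mxE.
by apply: eq_bigr => a _; rewrite -Ss mxE SE mulrC.
Qed.

Lemma pderiv2_riemannian_spray i j k :
  pderiv k (pderiv j (fun v => riemannian_spray h c x v i))
    = fun=> christoffel h c x j i k.
Proof.
rewrite pderiv_riemannian_spray; apply/funext => y.
have -> : (fun v => \sum_m christoffel h c x j i m * v 0 m)
    = pair (\row_m christoffel h c x j i m).
  by apply/funext => v; apply: eq_bigr => m _; rewrite mxE.
have [_] := is_derive_pair (\row_m christoffel h c x j i m) y (delta_mx 0 k).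
by rewrite /pderiv => ->; rewrite pair_delta mxE.
Qed.

Lemma parallel_berwald_connection y i j k : nabla h W c x = 0 -> 0 < t y ->
  berwald_connection F c x y j i k = christoffel h c x j i k.
Proof.
move=> N0 ty; have oOm := @open_kropina_cone _ _ H Wx.
have sE v : 0 < t v -> spray F c x v i = riemannian_spray h c x v i.
  move=> tv; have := congr1 (fun m : 'rV[R]_n => m 0 i) (parallel_kspray N0 tv).
  by rewrite !mxE.
have -> : christoffel h c x j i k
  = pderiv k (pderiv j (fun v => riemannian_spray h c x v i)) y.
  by rewrite pderiv2_riemannian_spray.
apply: (eq_on_pderiv _ oOm ty) => v tv.
exact: (eq_on_pderiv _ oOm tv).
Qed.

Lemma parallel_berwald_curvature y i j k l : nabla h W c x = 0 -> 0 < t y ->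
  berwald_curvature F c x y j i k l = 0.
Proof.
move=> N0 ty; rewrite /berwald_curvature.
rewrite (@eq_on_pderiv _ _ _ _ (fun=> christoffel h c x j i k) _ _
    (@open_kropina_cone _ _ H Wx) ty).
  by rewrite /pderiv derive_cst.
by move=> v tv; exact: parallel_berwald_connection.
Qed.

(** Both sprays are quadratic along the lines required by
    [quadratic_difference_rigidity], hence so is their difference. *)
Lemma berwald_parallel :
  (forall y, 0 < t y -> forall i j k l, berwald_curvature F c x y j i k l = 0) ->
  nabla h W c x = 0.
Proof.
move=> B; pose N := nabla h W c x *m H.
suff N0 : N = 0.
  have := congr1 (mulmx^~ (invmx H)) N0.
  by rewrite mulmxK ?metric_unitmx// mul0mx.
apply: (@quadratic_difference_rigidity _ _ H Wx N Hsym (metric_pair_gt0 h Ux)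
    (unitW Ux)).
  by move=> u; exact: nabla_unit.
move=> u Wu.
have tz z : t (Wx + z *: u) = 1 by rewrite /t pairDr pairZr Wu mulr0 addr0 unitW.
have Omz z : 0 < t (Wx + z *: u) by rewrite tz.
have oOm := @open_kropina_cone _ _ H Wx.
have quad i : exists abc : R * R * R, forall z,
    (kspray (Wx + z *: u) - rspray h c x (Wx + z *: u)) 0 i
      = abc.1.1 + abc.1.2 * z + abc.2 * z ^+ 2.
  have [a1 [b1 [c1 E1]]] := rational_line_quadratic oOm (rational_spray i) Omz
    (fun v tv j k l => B v tv i j k l).
  have R3 v : [set y | 0 < t y] v -> forall j k l, pderiv l (pderiv k (pderiv j
      (fun v => riemannian_spray h c x v i))) v = 0.
    by move=> _ j k l; rewrite pderiv2_riemannian_spray /pderiv derive_cst.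
  have [a2 [b2 [c2 E2]]] := rational_line_quadratic oOm (rational_riemannian_spray
      _ i) Omz R3.
  exists (a1 - a2, b1 - b2, c1 - c2) => z /=.
  rewrite [LHS]mxE [X in _ + X = _]mxE [kspray _ _ _]mxE [rspray _ _ _ _ _ _]mxE.
  by rewrite E1 E2; ring.
have [f fE] := choice quad.
exists (\row_i (f i).1.1 *m H), (\row_i (f i).1.2 *m H), (\row_i (f i).2 *m H) => z
    l y.
have := kspray_difference l (Omz z); rewrite /= -/y tz !mulr1 -/(s y) => <-.
congr (_ * _); rewrite [RHS]mxE ![(_ *m H) 0 l]mxE !mulr_suml -!big_split/=.
by apply: eq_bigr => i _; rewrite fE 3!mxE; ring.
Qed.

End KropinaSpray.

(** * Berwald spaces of Kropina type *)

Theorem theorem3p3 (R : realType) (n : nat) (M : topologicalType)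
    (A : smooth_manifold R n M)
    (a : riemannian_metric A) (b : one_form A)
    (kappa : M -> R) (h : riemannian_metric A) (W : vector_field A) :
  navigation_data a b kappa h W ->
  (berwald_space (kropina_dom b) (kropina a b) <-> parallel h W) /\
  (berwald_space (kropina_dom b) (kropina a b) ->
    (forall (c : A) (x y : 'rV[R]_n), chart_img c x -> kropina_dom b c x y ->
       forall i j k : 'I_n,
         berwald_connection (kropina a b) c x y j i k
           = christoffel h c x j i k) /\
    (forall (J : set R) (gamma : R -> M), open J -> is_interval J ->
       (finsler_geodesic J gamma (kropina_dom b) (kropina a b) <->
        admissible J gamma (kropina_dom b) /\
        riemannian_geodesic J gamma h))).
Proof.
move=> nav.
have unitW c z : chart_img c z -> pair (W c z *m h c z) (W c z) = 1.
  by move=> [p cp <-]; rewrite -qformE; case: (nav c p cp).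
have scale c z : chart_img c z -> exists2 e : R, 0 < e & forall v,
    pair (v *m h c z) v = e * pair (v *m a c z) v /\
    2 * pair (W c z *m h c z) v = e * beta b c z v.
  move=> Uz; have [p cp pz] := Uz; exists (expR (kappa p)); first exact: expR_gt0.
  move=> v; have [_ ha hb _] := nav c p cp; rewrite pz in ha hb; split.
    rewrite -!qformE /qform mulr_sumr; apply: eq_bigr => i _; rewrite mulr_sumr.
    by apply: eq_bigr => j _; rewrite ha !mulrA.
  rewrite /beta !mulr_sumr; apply: eq_bigr => i _; rewrite !mulrA -hb.
  congr (_ * _ * _); rewrite mxE; apply: eq_bigr => j _.
  by rewrite mulrC (metric_entry_sym h j i Uz).
have FE c z v : chart_img c z ->
    kropina a b c z v = pair (v *m h c z) v / (2 * pair (W c z *m h c z) v).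
  move=> Uz; have [e e0 /(_ v)[-> ->]] := scale c z Uz.
  rewrite /kropina /alpha sqr_sqrtr ?qformE; last first.
    have [->|v0] := eqVneq v 0; first by rewrite pair0r.
    exact: ltW (metric_pair_gt0 a Uz v0).
  by rewrite invfM mulrACA mulfV ?gt_eqF// mul1r.
have domE c z v : chart_img c z ->
    kropina_dom b c z v <-> 0 < pair (W c z *m h c z) v.
  move=> Uz; have [e e0 /(_ v)[_ E]] := scale c z Uz.
  rewrite /kropina_dom /=; rewrite -(pmulr_rgt0 _ e0) -E pmulr_rgt0//.
have parE : parallel h W <-> forall c x, chart_img c x -> nabla h W c x = 0.
  split=> [P c x Ux|P c x Ux i j].
    by apply/matrixP => j i; rewrite mxE [RHS]mxE; exact: P.
  have := congr1 (fun m : 'M[R]_n => m j i) (P c x Ux).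
  by rewrite mxE [RHS]mxE.
have BP : berwald_space (kropina_dom b) (kropina a b) <-> parallel h W.
  split=> [B|/parE P c x y Ux /(domE _ _ _ Ux) ty i j k l].
    apply/parE => c x Ux; apply: (berwald_parallel (unitW c) (FE c) Ux) => y ty.
    exact: B Ux ((domE c x y Ux).2 ty).
  exact: (parallel_berwald_curvature (unitW c) (FE c) Ux _ _ _ _ (P c x Ux) ty).
split=> // /BP/parE P; split.
  move=> c x y Ux /(domE _ _ _ Ux) ty i j k.
  exact: (parallel_berwald_connection (unitW c) (FE c) Ux _ _ _ (P c x Ux) ty).
have sE c x y i : chart_img c x -> kropina_dom b c x y ->
    spray (kropina a b) c x y i = riemannian_spray h c x y i.
  move=> Ux /(domE _ _ _ Ux) ty.
  have := congr1 (fun m : 'rV[R]_n => m 0 i)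
    (parallel_kspray (unitW c) (FE c) Ux (P c x Ux) ty).
  by rewrite !mxE.
move=> J gamma _ _; split=> -[adm [cont sol]]; split=> //; split=> // c t Jt ct.
  have Ux : chart_img c (coord_curve gamma c t) by exists (gamma t).
  have [d1 d2 E] := sol c t Jt ct; split=> // i.
  by rewrite -(sE _ _ _ i Ux (adm c t Jt ct)); exact: E.
have Ux : chart_img c (coord_curve gamma c t) by exists (gamma t).
have [d1 d2 E] := sol c t Jt ct; split=> // i.
by rewrite (sE _ _ _ i Ux (adm c t Jt ct)); exact: E.
Qed.
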